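(* There is a computable $2$-bounded coloring $g : [\mathbb{N}]^{!\omega} \to \mathbb{N}$ such that no infinite set $H \subseteq \mathbb{N}$ on whose exactly $\omega$-large subsets $g$ is injective is arithmetical.
   Context: For $X \subseteq \mathbb{N}$, $[X]^{!\omega}$ is the set of finite $s \subseteq X$ with $|s| = 1+\min s$. A function $g$ is $2$-bounded if every value has at most $2$ preimages. A set is arithmetical if it is definable in first-order arithmetic (equivalently, computable in $\emptyset^{(n)}$ for some $n$). (In the paper's terms: there is a computable instance of $\mathsf{RRT}^{!\omega}_2$ with no arithmetical solution.) *)

(* Defs.v *)
From mathcomp Require Import all_boot.
From mathcomp Require Import finmap.
From mathcomp Require Import boolp classical_sets functions cardinality.

Set Implicit Arguments.
Unset Strict Implicit.
Unset Printing Implicit Defensive.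

Local Open Scope classical_set_scope.
Local Open Scope card_scope.

(* [fset_min fset0] is the junk value 0, so [exactly_large fset0] is false. *)
Definition fset_min (s : {fset nat}) : nat := head 0 (sort leq s).

Definition exactly_large (s : {fset nat}) : bool := #|` s| == 1 + fset_min s.

(* The type of elements of [N]^{!omega}. *)
Definition large_set : Type := {s : {fset nat} | exactly_large s}.

(* [X]^{!omega}, as a subset of [N]^{!omega}. *)
Definition large_subsets (X : set nat) : set large_set :=
  [set s | forall x, x \in val s -> X x].

Definition bounded_coloring (T U : Type) (k : nat) (g : T -> U) : Prop :=
  forall y : U, g @^-1` [set y] #<= `I_k.

(* Partial recursive functions. Arities are not tracked: a program runs on a  *)
(* list of arguments, RSucc and RProj read a missing argument as 0, and RPrec *)
(* diverges on the empty list.                                                *)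
Inductive recfun : Type :=
| RZero
| RSucc
| RProj of nat
| RComp of recfun & seq recfun
| RPrec of recfun & recfun
| RMu of recfun.

(* [reval p v y]: the program [p] halts on the arguments [v] with output [y]. *)
Inductive reval : recfun -> seq nat -> nat -> Prop :=
| reval_zero v : reval RZero v 0
| reval_succ v : reval RSucc v (head 0 v).+1
| reval_proj i v : reval (RProj i) v (nth 0 v i)
| reval_comp f gs v ws y :
    size ws = size gs ->
    (forall i, i < size gs -> reval (nth RZero gs i) v (nth 0 ws i)) ->
    reval f ws y ->
    reval (RComp f gs) v y
| reval_prec0 f g v y :
    reval f v y -> reval (RPrec f g) (0 :: v) y
| reval_precS f g n v r y :
    reval (RPrec f g) (n :: v) r ->
    reval g [:: n, r & v] y ->
    reval (RPrec f g) (n.+1 :: v) y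
| reval_mu f v (w : nat -> nat) n :
    (forall k, k < n -> reval f (k :: v) (w k).+1) ->
    reval f (n :: v) 0 ->
    reval (RMu f) v n.

(* The canonical (strong) index of a finite set. *)
Definition canonical_index (s : {fset nat}) : nat := \sum_(x <- s) 2 ^ x.

Definition computable_coloring (g : large_set -> nat) : Prop :=
  exists p : recfun,
    forall s : large_set, reval p [:: canonical_index (val s)] (g s).

(* First-order arithmetic, with de Bruijn indices. *)
Inductive term : Type :=
| TVar of nat
| TZero
| TSucc of term
| TAdd of term & term
| TMul of term & term.

Inductive formula : Type :=
| FEq of term & term
| FNot of formula
| FAnd of formula & formula
| FEx of formula.

Fixpoint teval (e : nat -> nat) (t : term) : nat :=
  match t with
  | TVar i => e i
  | TZero => 0
  | TSucc t1 => (teval e t1).+1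
  | TAdd t1 t2 => teval e t1 + teval e t2
  | TMul t1 t2 => teval e t1 * teval e t2
  end.

Definition env_cons (x : nat) (e : nat -> nat) (i : nat) : nat :=
  if i is j.+1 then e j else x.

Fixpoint sat (e : nat -> nat) (phi : formula) : Prop :=
  match phi with
  | FEq t1 t2 => teval e t1 = teval e t2
  | FNot phi1 => ~ sat e phi1
  | FAnd phi1 phi2 => sat e phi1 /\ sat e phi2
  | FEx phi1 => exists x : nat, sat (env_cons x e) phi1
  end.

(* Quantifying over [e] forbids parameters: only variable 0 may matter. *)
Definition arithmetical (X : set nat) : Prop :=
  exists phi : formula,
    forall (x : nat) (e : nat -> nat), X x <-> sat (env_cons x e) phi.

(* Main.v *)
(** Write an exactly omega-large set as (n, x, bs), with n its minimum, x its
second element and bs the increasing list of the n - 1 others. Each code i < n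
denotes an arithmetical formula, which can be evaluated at x computably from bs
by bounding a quantifier at depth d by the d-th entry of bs and doing arithmetic
modulo the last entry. This assigns to x a type, the set of the codes i < n that
hold at x. The coloring merges (n, a, bs) with (n, b, bs) when a and b are the
first two numbers above n of a given type, and is otherwise injective.

If each entry of bs is large enough with respect to the previous ones, the
bounded evaluation gives the true values (with quantifiers at depth n - 2 or
more replaced by falsity). Let H be infinite and defined by the formula of code
i, and let n in H be large. By the pigeonhole principle two elements of H above
n have the same true type, so the first two numbers a < b of that type are in H,
since the type decides membership in H. Choosing bs in H sparse enough, the sets
(n, a, bs) and (n, b, bs) are included in H and have the same color.

The coloring is computable because the values of all codes i < n at all
environments fit in one number, a table which is iterated n times. *)

Require Import Defs.
From mathcomp Require Import all_boot.
From mathcomp Require Import finmap zify.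
From mathcomp Require Import boolp classical_sets functions cardinality.

Set Implicit Arguments.
Unset Strict Implicit.
Unset Printing Implicit Defensive.

(** * Computability of total functions of fixed arity *)

Definition crec (k : nat) (f : seq nat -> nat) : Prop :=
  exists p, forall v, size v = k -> reval p v (f v).

Lemma crec_ext k f g : f =1 g -> crec k f -> crec k g.
Proof. by move=> fg [p hp]; exists p => v hv; rewrite -fg; apply: hp. Qed.

Lemma crec_nth k i : crec k (fun v => nth 0 v i).
Proof. by exists (RProj i) => v _; apply: reval_proj. Qed.

Lemma crec_comp k F fs : crec (size fs) F ->
  (forall i, i < size fs -> crec k (nth (fun=> 0) fs i)) ->
  crec k (fun v => F [seq f v | f <- fs]).
Proof.
move=> [p hp] hfs.
have [gs [sgs hgs]] : exists gs, size gs = size fs /\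
    forall v, size v = k -> forall i, i < size fs ->
    reval (nth RZero gs i) v (nth 0 [seq f v | f <- fs] i).
  elim: fs hfs {p hp} => [|f fs IH] hfs; first by exists [::].
  have [|gs [sgs hgs]] := IH; first by move=> i hi; apply: (hfs i.+1).
  have [q hq] := hfs 0 isT.
  exists (q :: gs); split=> [|v hv [|i] hi] /=; first by rewrite sgs.
    exact: hq.
  exact: hgs.
exists (RComp p gs) => v hv.
apply: (@reval_comp _ _ _ [seq f v | f <- fs]); rewrite ?size_map //.
  by move=> i hi; apply: hgs => //; rewrite -sgs.
by apply: hp; rewrite size_map.
Qed.

Lemma crec_comp1 k F f : crec 1 (fun v => F (nth 0 v 0)) -> crec k f ->
  crec k (fun v => F (f v)).
Proof. by move=> hF hf; apply: (@crec_comp k _ [:: f] hF) => -[]. Qed.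

Lemma crec_comp2 k F f g : crec 2 (fun v => F (nth 0 v 0) (nth 0 v 1)) ->
  crec k f -> crec k g -> crec k (fun v => F (f v) (g v)).
Proof.
by move=> hF hf hg; apply: (@crec_comp k _ [:: f; g] hF) => -[|[]].
Qed.

(** Programs have no instruction that drops an argument, so the tail is rebuilt from projections. *)
Lemma crec_behead k f : crec k f -> crec k.+1 (fun w => f (behead w)).
Proof.
move=> hf.
have := @crec_comp k.+1 f [seq (fun v => nth 0 v i) | i <- iota 1 k].
rewrite size_map size_iota => /(_ hf) [|p hp].
  move=> i hi; rewrite (nth_map 0) ?size_iota // nth_iota //.
  exact: crec_nth.
exists p => -[//|a v] /= [hv]; have := hp (a :: v).
rewrite /= hv => /(_ erefl); congr (reval _ _ (f _)).
rewrite -map_comp; apply: (@eq_from_nth _ 0); rewrite size_map size_iota //.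
by move=> i hi; rewrite (nth_map 0) ?size_iota // nth_iota.
Qed.

Lemma crec_behead2 k f :
  crec k f -> crec k.+2 (fun w => f (behead (behead w))).
Proof. by move=> hf; exact: crec_behead (crec_behead hf). Qed.

(** [RPrec] recurses on its first argument, so the number of steps is prepended to the argument
    list, itself rebuilt from projections. *)
Lemma crec_iteri k N A G : crec k N -> crec k A ->
  crec k.+2 (fun w => G (nth 0 w 0) (nth 0 w 1) (behead (behead w))) ->
  crec k (fun v => iteri (N v) (fun i r => G i r v) (A v)).
Proof.
move=> hN [pA hA] [pG hG].
have hF : crec k.+1
    (fun w => iteri (head 0 w) (fun i r => G i r (behead w)) (A (behead w))).
  exists (RPrec pA pG) => -[//|n v] /= [hv].
  elim: n => [|n IH] /=; first by apply/reval_prec0/hA.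
  by apply: reval_precS IH _; apply: (hG [:: n, _ & v]); rewrite /= hv.
have := @crec_comp k _ (N :: [seq (fun v => nth 0 v i) | i <- iota 0 k]).
rewrite /= size_map size_iota => /(_ _ hF) [|p hp].
  move=> [|i] hi //=; rewrite (nth_map 0) ?size_iota // nth_iota //.
  exact: crec_nth.
exists p => v hv; have /= := hp v hv.
rewrite -map_comp.
suff -> : [seq ((fun f => f v) \o (fun i v => nth 0 v i)) i
    | i <- iota 0 k] = v by [].
by rewrite -{1}hv; apply: mkseq_nth.
Qed.

Lemma crec0 k : crec k (fun=> 0).
Proof. by exists RZero => v _; apply: reval_zero. Qed.

Lemma crecS k f : crec k f -> crec k (fun v => (f v).+1).
Proof.
move=> hf; apply: (@crec_comp1 k succn) => //.
by exists RSucc => v _; rewrite nth0; apply: reval_succ.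
Qed.

Lemma crec_cst k n : crec k (fun=> n).
Proof. by elim: n => [|n IH]; [exact: crec0 | exact: crecS]. Qed.

Lemma crecD k f g : crec k f -> crec k g -> crec k (fun v => f v + g v).
Proof.
move=> hf hg.
apply: (@crec_ext _ (fun v => iteri (g v) (fun i r => r.+1) (f v))).
  by move=> v; elim: (g v) => [|n /= ->]; rewrite ?addn0 ?addnS.
by apply: crec_iteri hg hf _; apply/crecS/crec_nth.
Qed.

Lemma crecM k f g : crec k f -> crec k g -> crec k (fun v => f v * g v).
Proof.
move=> hf hg.
apply: (@crec_ext _ (fun v => iteri (g v) (fun i r => r + f v) 0)).
  by move=> v; elim: (g v) => [|n /= ->]; rewrite ?muln0 ?mulnSr.
apply: (@crec_iteri _ _ _ (fun _ r v => r + f v)) => //; first exact: crec0.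
by apply: crecD; [exact: crec_nth | exact: crec_behead2].
Qed.

Lemma crecX k f g : crec k f -> crec k g -> crec k (fun v => f v ^ g v).
Proof.
move=> hf hg.
apply: (@crec_ext _ (fun v => iteri (g v) (fun i r => f v * r) 1)).
  by move=> v; elim: (g v) => [|n /= ->]; rewrite ?expn0 ?expnS.
apply: (@crec_iteri _ _ _ (fun _ r v => f v * r)) => //; first exact: crec_cst.
by apply: crecM; [exact: crec_behead2 | exact: crec_nth].
Qed.

Lemma crecB k f g : crec k f -> crec k g -> crec k (fun v => f v - g v).
Proof.
move=> hf hg.
apply: (@crec_ext _ (fun v => iteri (g v) (fun i r => r.-1) (f v))).
  by move=> v; elim: (g v) => [|n /= ->]; rewrite ?subn0 ?subnS.
apply: crec_iteri hg hf _; apply: (@crec_comp1 _ predn); last exact: crec_nth.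
(* The last index visited by an iteration of length m > 0 is m - 1, which yields the predecessor. *)
apply: (@crec_ext _ (fun v => iteri (nth 0 v 0) (fun i _ => i) 0)).
  by move=> v; case: (nth 0 v 0).
apply: (@crec_iteri _ _ _ (fun i _ _ => i)); first exact: crec_nth.
  exact: crec0.
exact: crec_nth.
Qed.

Lemma crec_leq k f g : crec k f -> crec k g -> crec k (fun v => f v <= g v).
Proof.
move=> hf hg; apply: (@crec_ext _ (fun v => 1 - (f v - g v))).
  by move=> v; rewrite /leq; case: (f v - g v).
by apply: crecB; [exact: crec_cst | exact: crecB].
Qed.

Lemma crec_neg k (b : seq nat -> bool) : crec k b -> crec k (fun v => ~~ b v).
Proof.
move=> hb; apply: (@crec_ext _ (fun v => 1 - b v)).
  by move=> v; case: (b v).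
by apply: crecB => //; exact: crec_cst.
Qed.

Lemma crec_and k (b1 b2 : seq nat -> bool) : crec k b1 -> crec k b2 ->
  crec k (fun v => b1 v && b2 v).
Proof.
move=> h1 h2; apply: (@crec_ext _ (fun v => b1 v * b2 v)); last exact: crecM.
by move=> v; rewrite mulnb.
Qed.

Lemma crec_eqn k f g : crec k f -> crec k g -> crec k (fun v => f v == g v).
Proof.
move=> hf hg; apply: (@crec_ext _ (fun v => (f v <= g v) && (g v <= f v))).
  by move=> v; rewrite eqn_leq.
by apply: crec_and; exact: crec_leq.
Qed.

Lemma crec_eqb k (b1 b2 : seq nat -> bool) : crec k b1 -> crec k b2 ->
  crec k (fun v => b1 v == b2 v).
Proof.
move=> h1 h2; apply: (@crec_ext _ (fun v => b1 v == b2 v :> nat)).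
  by move=> v; case: (b1 v); case: (b2 v).
exact: crec_eqn.
Qed.

Lemma crec_if k (b : seq nat -> bool) f g : crec k b -> crec k f -> crec k g ->
  crec k (fun v => if b v then f v else g v).
Proof.
move=> hb hf hg; apply: (@crec_ext _ (fun v => b v * f v + (~~ b v) * g v)).
  by move=> v; case: (b v); rewrite ?mul1n ?addn0.
by apply: crecD; apply: crecM => //; exact: crec_neg.
Qed.

Lemma crec_sum k N F : crec k N ->
  crec k.+1 (fun w => F (nth 0 w 0) (behead w)) ->
  crec k (fun v => \sum_(0 <= i < N v) F i v).
Proof.
move=> hN hF.
apply: (@crec_ext _ (fun v => iteri (N v) (fun i r => r + F i v) 0)).
  move=> v; elim: (N v) => [|n /= ->]; first by rewrite big_geq.
  by rewrite big_nat_recr.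
apply: (@crec_iteri _ _ _ (fun i r v => r + F i v)) => //; first exact: crec0.
apply: crecD; first exact: crec_nth.
have /= := @crec_comp k.+2 _
  ((nth 0)^~ 0 :: [seq (fun v => nth 0 v i) | i <- iota 2 k]).
rewrite size_map size_iota => /(_ _ hF) [|p hp].
  move=> [|i] hi; first exact: crec_nth.
  rewrite /= (nth_map 0) ?size_iota // nth_iota //; exact: crec_nth.
exists p => -[//|a [//|b v]] /= [hv]; have /= := hp [:: a, b & v].
rewrite hv -map_comp => /(_ erefl).
suff -> : [seq ((fun f => f [:: a, b & v]) \o (fun i v => nth 0 v i)) i
    | i <- iota 2 k] = v by [].
apply: (@eq_from_nth _ 0); rewrite size_map size_iota //.
by move=> i hi; rewrite (nth_map 0) ?size_iota // nth_iota.
Qed.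

Lemma sum_nat_pred N (P : pred nat) :
  \sum_(0 <= i < N) P i = count P (iota 0 N).
Proof.
rewrite -sum1_count [RHS]big_mkcond /index_iota subn0.
by apply: eq_bigr => i _; case: (P i).
Qed.

Lemma crec_has k N (P : nat -> seq nat -> bool) : crec k N ->
  crec k.+1 (fun w => P (nth 0 w 0) (behead w)) ->
  crec k (fun v => has (fun i => P i v) (iota 0 (N v))).
Proof.
move=> hN hP.
apply: (@crec_ext _ (fun v => 0 < \sum_(0 <= i < N v) P i v)).
  by move=> v; rewrite has_count sum_nat_pred.
by apply: crec_leq; [exact: crec_cst | exact: crec_sum].
Qed.

Lemma crec_all k N (P : nat -> seq nat -> bool) : crec k N ->
  crec k.+1 (fun w => P (nth 0 w 0) (behead w)) ->
  crec k (fun v => all (fun i => P i v) (iota 0 (N v))).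
Proof.
move=> hN hP.
apply: (@crec_ext _ (fun v => ~~ has (fun i => ~~ P i v) (iota 0 (N v)))).
  by move=> v; rewrite has_predC negbK.
by apply/crec_neg/(@crec_has _ _ (fun i v => ~~ P i v)) => //; apply: crec_neg.
Qed.

Lemma sum_ltn_minn m q : \sum_(0 <= i < m) (i < q) = minn m q.
Proof.
elim: m => [|m IH]; first by rewrite big_geq // min0n.
by rewrite big_nat_recr //= IH; lia.
Qed.

(** The quotient counts the positive multiples of the divisor up to the dividend; the first factor
    gives 0 for division by 0. *)
Lemma crec_div k f g : crec k f -> crec k g -> crec k (fun v => f v %/ g v).
Proof.
move=> hf hg.
apply: (@crec_ext _
  (fun v => (0 < g v) * \sum_(0 <= i < f v) (i.+1 * g v <= f v))).
  move=> v; case: (posnP (g v)) => [->|g0]; first by rewrite divn0.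
  rewrite mul1n -[RHS](minn_idPr (leq_div (f v) (g v))) -sum_ltn_minn.
  by apply: eq_bigr => i _; rewrite leq_divRL.
apply: crecM; first by apply: crec_leq => //; exact: crec_cst.
apply: (@crec_sum _ _ (fun i v => i.+1 * g v <= f v)) => //.
apply: crec_leq; last exact: crec_behead.
by apply: crecM; [exact/crecS/crec_nth | exact: crec_behead].
Qed.

Lemma crec_mod k f g : crec k f -> crec k g -> crec k (fun v => f v %% g v).
Proof.
move=> hf hg; apply: (@crec_ext _ (fun v => f v - f v %/ g v * g v)).
  by move=> v; rewrite {1}(divn_eq (f v) (g v)) addKn.
by apply: crecB => //; apply: crecM => //; exact: crec_div.
Qed.

Lemma crec_min k f g : crec k f -> crec k g ->
  crec k (fun v => minn (f v) (g v)).
Proof.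
move=> hf hg; apply: (@crec_ext _ (fun v => f v - (f v - g v))).
  by move=> v; rewrite -minnE.
by do 2 apply: crecB => //.
Qed.

Lemma crec_nth_behead k i : crec k (fun w => nth 0 (behead w) i).
Proof.
apply: (crec_ext (f := fun w => nth 0 w i.+1)); last exact: crec_nth.
by move=> w; rewrite nth_behead.
Qed.

Lemma crec_nth_behead2 k i : crec k (fun w => nth 0 (behead (behead w)) i).
Proof.
apply: (crec_ext (f := fun w => nth 0 w i.+2)); last exact: crec_nth.
by move=> w; rewrite !nth_behead.
Qed.

Ltac crec_step := match goal with
  | H : crec ?k ?f |- crec ?k ?f => exact H
  | |- crec _ (fun v => ?f v) => is_var f; assumption
  | |- crec _ (fun v => nat_of_bool (?f v)) => is_var f; assumption
  | |- crec _ (fun=> _) => exact: crec_cst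
  | |- crec _ (fun w => nth _ w _) => exact: crec_nth
  | |- crec _ (fun w => nth _ (behead w) _) => exact: crec_nth_behead
  | |- crec _ (fun w => nth _ (behead (behead w)) _) => exact: crec_nth_behead2
  | |- crec _ (fun w => _.+1) => apply: crecS
  | |- crec _ (fun w => _ + _) => apply: crecD
  | |- crec _ (fun w => _ * _) => apply: crecM
  | |- crec _ (fun w => _ ^ _) => apply: crecX
  | |- crec _ (fun w => _ - _) => apply: crecB
  | |- crec _ (fun w => _ %/ _) => apply: crec_div
  | |- crec _ (fun w => _ %% _) => apply: crec_mod
  | |- crec _ (fun w => minn _ _) => apply: crec_min
  | |- crec _ (fun w => nat_of_bool (_ && _)) => apply: crec_and
  | |- crec _ (fun w => nat_of_bool (_ == _)) =>
      first [apply: crec_eqn | apply: crec_eqb]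
  | |- crec _ (fun w => nat_of_bool (_ <= _)) => apply: crec_leq
  | |- crec _ (fun w => if _ then _ else _) => apply: crec_if
  | |- crec _ (fun w => ?f (behead (behead (behead w)))) =>
      apply: (@crec_behead _ (fun v => f (behead (behead v))))
  | |- crec _ (fun w => ?f (behead (behead w))) => apply: crec_behead2
  | |- crec _ (fun w => ?f (behead w)) => apply: crec_behead
  end.

(* [elt c j] is the [j]-th element, in increasing order, of the finite set of
   canonical index [c], and 0 if that set has at most [j] elements. *)
Definition bit (c y : nat) : nat := (c %/ 2 ^ y) %% 2.

Definition elt (c j : nat) : nat :=
  \sum_(0 <= y < c) y * bit c y * (\sum_(0 <= i < y) bit c i == j).

Lemma crec_bit k f g : crec k f -> crec k g ->
  crec k (fun v => bit (f v) (g v)).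
Proof. by move=> hf hg; rewrite /bit; repeat crec_step. Qed.

Lemma crec_elt k f g : crec k f -> crec k g ->
  crec k (fun v => elt (f v) (g v)).
Proof.
move=> hf hg; apply: (@crec_comp2 _ elt) => //; rewrite /elt.
apply: (@crec_sum _ _ (fun y v => y * bit (nth 0 v 0) y *
  (\sum_(0 <= i < y) bit (nth 0 v 0) i == nth 0 v 1))).
  exact: crec_nth.
apply: crecM; first by apply: crecM; [|apply: crec_bit]; repeat crec_step.
apply: crec_eqn; last by repeat crec_step.
apply: (@crec_sum _ _ (fun i w => bit (nth 0 (behead w) 0) i)).
  exact: crec_nth.
by apply: crec_bit; repeat crec_step.
Qed.

(* The set with elements op < op + 1 + a < op + a + b + 2 codes the node with
   label op and subcodes a and b. The truncations at c make subcodes of c at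
   most c for every c, so that they stay within the table. *)
Definition code_op (c : nat) : nat := elt c 0.
Definition code_left (c : nat) : nat := minn c (elt c 1 - (elt c 0).+1).
Definition code_right (c : nat) : nat := minn c (elt c 2 - (elt c 1).+1).

(* Terms and formulas share one syntax, truth values being 0 and 1: op = 0 is a
   variable, 1 addition, 2 multiplication, 3 equality, 4 or more a quantifier.
   At modulus [z = 0] the reductions mod [z] disappear. *)
Definition node (z op var a b : nat) (q : bool) : nat :=
  if op == 0 then var else
  if op == 1 then (a + b) %% z else
  if op == 2 then (a * b) %% z else
  if op == 3 then nat_of_bool (a == b) else nat_of_bool q.

(** * The coloring as a function of the canonical index *)

(* [c] is the canonical index of (n, x, bs): [n = elt c 0], [x = elt c 1], and
   [elt c d.+2] is the entry [d] of bs. *)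
Definition modulus (c : nat) : nat := elt c (elt c 0 - 2).+2.
Definition bound (c d : nat) : nat :=
  if d.+2 < elt c 0 then elt c d.+2 else 0.
Definition env_bound (c : nat) : nat := modulus c ^ elt c 0.

(* [R] lists in base [modulus c] the values of the codes [i < n] at the depths
   [d < n] and environments [e < env_bound c], also written in that base. *)
Definition lookup (c R i d e : nat) : nat :=
  (R %/ modulus c ^ ((i * elt c 0 + d) * env_bound c + e)) %% modulus c.

(** The position [j] is split as in [lookup], and [y + modulus c * e] encodes the environment [e]
    with [y] pushed in front. *)
Definition entry (c R j : nat) : nat :=
  let i := j %/ env_bound c %/ elt c 0 in
  let d := j %/ env_bound c %% elt c 0 in
  let e := j %% env_bound c in
  node (modulus c) (code_op i) ((e %/ modulus c ^ code_left i) %% modulus c)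
    (lookup c R (code_left i) d e) (lookup c R (code_right i) d e)
    (has (fun y => 0 < lookup c R (code_left i) d.+1 (y + modulus c * e))
         (iota 0 (bound c d))).

(** Each round evaluates every code one level deeper, from the zero table on, so [k] rounds simulate
    a recursion with fuel [k]. *)
Definition table (c k : nat) : nat :=
  iteri k (fun _ R => \sum_(0 <= j < elt c 0 * elt c 0 * env_bound c)
                        entry c R j * modulus c ^ j) 0.

(** When the minimum is at most 1 there are no further entries to bound the evaluation, and no
    merging takes place. *)
Definition table_equiv (c y x : nat) : bool :=
  (1 < elt c 0) &&
  all (fun i => (0 < lookup c (table c (elt c 0)) i 0 y) ==
                (0 < lookup c (table c (elt c 0)) i 0 x)) (iota 0 (elt c 0)).

(** Counting and summing replace a search: when only one earlier number has the type of [x], the sum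
    is that number. *)
Definition table_leader (c x : nat) : nat :=
  if \sum_(0 <= y < x) ((elt c 0 < y) && table_equiv c y x) == 1
  then \sum_(0 <= y < x) y * ((elt c 0 < y) && table_equiv c y x) else x.

Definition index_coloring (c : nat) : nat :=
  c - 2 ^ elt c 1 + 2 ^ table_leader c (elt c 1).

(** * Computability of the coloring *)

Lemma crec_code_op k f : crec k f -> crec k (fun v => code_op (f v)).
Proof. by move=> hf; apply: crec_elt => //; exact: crec_cst. Qed.

Lemma crec_code_left k f : crec k f -> crec k (fun v => code_left (f v)).
Proof.
move=> hf; rewrite /code_left; repeat first [crec_step | apply: crec_elt].
Qed.

Lemma crec_code_right k f : crec k f -> crec k (fun v => code_right (f v)).
Proof.
move=> hf; rewrite /code_right; repeat first [crec_step | apply: crec_elt].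
Qed.

Lemma crec_node k z op var a b (q : seq nat -> bool) :
  crec k z -> crec k op -> crec k var -> crec k a -> crec k b -> crec k q ->
  crec k (fun v => node (z v) (op v) (var v) (a v) (b v) (q v)).
Proof. by move=> *; rewrite /node; repeat crec_step. Qed.

Lemma crec_modulus k f : crec k f -> crec k (fun v => modulus (f v)).
Proof.
by move=> hf; rewrite /modulus; repeat first [crec_step | apply: crec_elt].
Qed.

Lemma crec_bound k f g : crec k f -> crec k g ->
  crec k (fun v => bound (f v) (g v)).
Proof.
by move=> hf hg; rewrite /bound; repeat first [crec_step | apply: crec_elt].
Qed.

Lemma crec_env_bound k f : crec k f -> crec k (fun v => env_bound (f v)).
Proof.
move=> hf; rewrite /env_bound.
by repeat first [crec_step | apply: crec_elt | apply: crec_modulus].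
Qed.

Ltac crec_step' := match goal with
  | |- crec _ (fun w => elt _ _) => apply: crec_elt
  | |- crec _ (fun w => modulus _) => apply: crec_modulus
  | |- crec _ (fun w => bound _ _) => apply: crec_bound
  | |- crec _ (fun w => env_bound _) => apply: crec_env_bound
  | |- crec _ (fun w => code_op _) => apply: crec_code_op
  | |- crec _ (fun w => code_left _) => apply: crec_code_left
  | |- crec _ (fun w => code_right _) => apply: crec_code_right
  | |- _ => crec_step
  end.

Lemma crec_lookup k f1 f2 f3 f4 f5 :
  crec k f1 -> crec k f2 -> crec k f3 -> crec k f4 -> crec k f5 ->
  crec k (fun v => lookup (f1 v) (f2 v) (f3 v) (f4 v) (f5 v)).
Proof. by move=> *; rewrite /lookup; repeat crec_step'. Qed.

Lemma crec_entry k f g h : crec k f -> crec k g -> crec k h ->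
  crec k (fun v => entry (f v) (g v) (h v)).
Proof.
move=> hf hg hh; rewrite /entry; apply: crec_node;
  repeat first [crec_step' | apply: crec_lookup].
apply: (@crec_has _ _ (fun y v => 0 < lookup (f v) (g v)
  (code_left (h v %/ env_bound (f v) %/ elt (f v) 0))
  (h v %/ env_bound (f v) %% elt (f v) 0).+1
  (y + modulus (f v) * (h v %% env_bound (f v)))));
  by repeat first [crec_step' | apply: crec_lookup].
Qed.

Lemma crec_table k f g : crec k f -> crec k g ->
  crec k (fun v => table (f v) (g v)).
Proof.
move=> hf hg; rewrite /table.
apply: (@crec_iteri _ _ _ (fun _ R v =>
  \sum_(0 <= j < elt (f v) 0 * elt (f v) 0 * env_bound (f v))
     entry (f v) R j * modulus (f v) ^ j)) => //; first exact: crec_cst.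
apply: (@crec_sum _ _ (fun j w => entry (f (behead (behead w))) (nth 0 w 1) j *
  modulus (f (behead (behead w))) ^ j)); first by repeat crec_step'.
by repeat first [crec_step' | apply: crec_entry].
Qed.

Lemma crec_table_equiv k f g h : crec k f -> crec k g -> crec k h ->
  crec k (fun v => table_equiv (f v) (g v) (h v)).
Proof.
move=> hf hg hh; rewrite /table_equiv; apply: crec_and.
  by repeat crec_step'.
apply: (@crec_all _ _ (fun i v =>
  (0 < lookup (f v) (table (f v) (elt (f v) 0)) i 0 (g v)) ==
  (0 < lookup (f v) (table (f v) (elt (f v) 0)) i 0 (h v))));
  by repeat first [crec_step' | apply: crec_lookup | apply: crec_table].
Qed.

Lemma crec_table_leader k f g : crec k f -> crec k g ->
  crec k (fun v => table_leader (f v) (g v)).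
Proof.
move=> hf hg; rewrite /table_leader; apply: crec_if => //.
  apply: crec_eqn; last exact: crec_cst.
  apply: (@crec_sum _ _ (fun y v => (elt (f v) 0 < y) &&
    table_equiv (f v) y (g v))) => //.
  by repeat first [crec_step' | apply: crec_table_equiv].
apply: (@crec_sum _ _ (fun y v => y * ((elt (f v) 0 < y) &&
  table_equiv (f v) y (g v)))) => //.
by repeat first [crec_step' | apply: crec_table_equiv].
Qed.

Lemma crec_index_coloring : crec 1 (fun v => index_coloring (nth 0 v 0)).
Proof.
rewrite /index_coloring.
by repeat first [crec_step' | apply: crec_table_leader].
Qed.

(** * Digits and canonical indices *)

Lemma digit_lt b (f : nat -> nat) L j : (forall i, f i < b) -> j < L ->
  ((\sum_(0 <= i < L) f i * b ^ i) %/ b ^ j) %% b = f j.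
Proof.
elim: j f L => [|j IH] f [//|L] fb hj;
  have b0 : 0 < b by (apply: leq_ltn_trans (fb 0)).
all: have -> : \sum_(0 <= i < L.+1) f i * b ^ i =
  (\sum_(0 <= i < L) f i.+1 * b ^ i) * b + f 0.
1,3: rewrite big_nat_recl // expn0 muln1 addnC big_distrl /=.
1,2: by congr (_ + _); apply: eq_bigr => i _; rewrite expnS mulnCA mulnC.
- by rewrite expn0 divn1 modnMDl modn_small.
- by rewrite expnS divnMA divnMDl // (divn_small (fb 0)) addn0 IH.
Qed.

Definition set_index (l : seq nat) : nat := \sum_(x <- l) 2 ^ x.

Lemma set_index_nat l L : sorted ltn l -> (forall x, x \in l -> x < L) ->
  set_index l = \sum_(0 <= i < L) (i \in l) * 2 ^ i.
Proof.
move=> sl hL; rewrite /set_index.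
have -> : \sum_(x <- l) 2 ^ x = \sum_(x <- iota 0 L | x \in l) 2 ^ x.
  rewrite -[RHS]big_filter; apply: perm_big; apply: uniq_perm.
  - exact: (sorted_uniq ltn_trans ltnn sl).
  - exact/filter_uniq/iota_uniq.
  - move=> x; rewrite mem_filter mem_iota add0n /= ; case xl: (x \in l) => //=.
    by rewrite hL.
rewrite big_mkcond /index_iota subn0; apply: eq_bigr => i _.
by case: (i \in l); rewrite ?mul1n.
Qed.

Lemma bit_set_index l y : sorted ltn l -> bit (set_index l) y = (y \in l).
Proof.
move=> sl; rewrite (@set_index_nat l (maxn y (\max_(x <- l) x)).+1) //.
  rewrite /bit (@digit_lt 2 (fun i => i \in l)) // ?ltnS ?leq_maxl //.
  by move=> i; case: (i \in l).
move=> x xl; rewrite ltnS leq_max; apply/orP; right.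
by rewrite (big_rem x) //= leq_maxl.
Qed.

Lemma set_index_inj l1 l2 : sorted ltn l1 -> sorted ltn l2 ->
  set_index l1 = set_index l2 -> l1 = l2.
Proof.
move=> s1 s2 e; apply: (irr_sorted_eq ltn_trans ltnn s1 s2) => y.
have := bit_set_index y s1; rewrite e bit_set_index //.
by case: (y \in l1); case: (y \in l2).
Qed.

Lemma count_ltn_nth l j : sorted ltn l -> j < size l ->
  count (fun i => i < nth 0 l j) l = j.
Proof.
elim: l j => [//|a l IH] [|j] /= hp hj.
  rewrite ltnn add0n; apply/eqP; rewrite -leqn0 leqNgt -has_count.
  apply/hasPn => x xl; rewrite -leqNgt ltnW //.
  by have /allP := order_path_min ltn_trans hp; apply.
rewrite IH ?(path_sorted hp) //.
have /allP /(_ (nth 0 l j)) -> := order_path_min ltn_trans hp => //.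
exact: mem_nth.
Qed.

Lemma mem_lt_set_index l x : x \in l -> x < set_index l.
Proof.
move=> xl; apply: leq_trans (ltn_expl _ (ltnSn 1)) _.
by rewrite /set_index (big_rem _ xl) /= leq_addr.
Qed.

(** An element of [l] has as many smaller elements in [l] as its position, so only the term for
    position [j] survives in the sum; it is in range because elements are below the index. *)
Lemma elt_set_index l j : sorted ltn l -> elt (set_index l) j = nth 0 l j.
Proof.
move=> sl; have ul := sorted_uniq ltn_trans ltnn sl.
have cnt y : y \in l -> \sum_(0 <= i < y) bit (set_index l) i = index y l.
  move=> yl; rewrite (eq_bigr (fun i => (i \in l) : nat)); last first.
    by move=> i _; rewrite bit_set_index.
  rewrite sum_nat_pred -[RHS](@count_ltn_nth l (index y l)) ?index_mem //.
  rewrite nth_index // -!size_filter; apply/perm_size/uniq_perm.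
  - exact/filter_uniq/iota_uniq.
  - exact: filter_uniq.
  - by move=> i; rewrite !mem_filter mem_iota add0n /= andbC.
rewrite /elt.
rewrite (eq_bigr (fun y => if (y \in l) && (index y l == j) then y else 0));
  last first.
  move=> y _; rewrite bit_set_index //; case yl: (y \in l); rewrite ?muln0 //.
  by rewrite cnt // muln1; case: (index y l == j); rewrite ?muln1 ?muln0.
rewrite -big_mkcond; case: (ltnP j (size l)) => hj; last first.
  rewrite nth_default // big1 // => i /andP[il /eqP ij].
  by move: il; rewrite -index_mem ij ltnNge hj.
rewrite (eq_bigl (pred1 (nth 0 l j))).
  rewrite -big_filter (_ : [seq _ <- _ | _] = [:: nth 0 l j]) ?big_seq1 //.
  rewrite (filter_pred1_uniq (iota_uniq _ _)) // mem_iota subn0 add0n /=.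
  exact/mem_lt_set_index/mem_nth.
move=> y /=; apply/andP/eqP => [[yl /eqP <-]|->].
  by rewrite nth_index.
by rewrite mem_nth // index_uniq.
Qed.

(** * Bounded evaluation *)

(* [k] is fuel, and [ex] interprets a quantifier as a function of the length of
   the environment, which is one more than the quantifier depth. *)
Fixpoint eval (z : nat) (ex : nat -> pred nat -> bool) (k i : nat)
    (rho : seq nat) : nat :=
  if k is k'.+1 then
    node z (code_op i) (nth 0 rho (code_left i))
      (eval z ex k' (code_left i) rho) (eval z ex k' (code_right i) rho)
      (ex (size rho) (fun y => 0 < eval z ex k' (code_left i) (y :: rho)))
  else 0.

(** An environment of length [d] has quantifier depth [d - 1], hence the shifted index. The test on
    [d] keeps the last entry of [bs] for the modulus. *)
Definition below (bs : seq nat) (d : nat) (p : pred nat) : bool :=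
  has p (iota 0 (if d < size bs then nth 0 bs d.-1 else 0)).

Definition beval (bs : seq nat) := eval (last 0 bs) (below bs).

Lemma node_lt z op var a b q : 1 < z -> var < z -> node z op var a b q < z.
Proof.
move=> z1 hv; have z0 : 0 < z by exact: ltnW.
rewrite /node; case: (op == 0) => //.
case: (op == 1); first by rewrite ltn_pmod.
case: (op == 2); first by rewrite ltn_pmod.
by case: (op == 3); [case: (a == b) | case: q].
Qed.

Definition env_code (z : nat) (rho : seq nat) : nat :=
  foldr (fun y e => y + z * e) 0 rho.

Lemma env_code_lt z rho : all (gtn z) rho -> env_code z rho < z ^ size rho.
Proof.
elim: rho => [//|y rho IH] /= /andP[yz /IH h].
rewrite expnS; apply: (@leq_trans (z + z * env_code z rho)).
  by rewrite ltn_add2r.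
by rewrite -mulnS leq_mul2l h orbT.
Qed.

Lemma digit_env_code z rho a : all (gtn z) rho ->
  (env_code z rho %/ z ^ a) %% z = nth 0 rho a.
Proof.
elim: rho a => [|y rho IH] a; first by rewrite /= div0n mod0n nth_nil.
move=> /= /andP[yz h]; have z0 : 0 < z by exact: leq_ltn_trans yz.
rewrite addnC mulnC; case: a => [|a] /=.
  by rewrite expn0 divn1 modnMDl modn_small.
by rewrite expnS divnMA divnMDl // (divn_small yz) addn0 IH.
Qed.

Lemma sorted_le_last bs d : sorted ltn bs -> d < size bs ->
  nth 0 bs d <= last 0 bs.
Proof.
move=> sb db; rewrite -nth_last.
apply: (sorted_leq_nth leq_trans leqnn); rewrite ?inE //; try by lia.
by apply: sub_sorted sb => x y; exact: ltnW.
Qed.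

Section Table.
Variables (n x : nat) (bs : seq nat).
Hypotheses (n2 : 1 < n) (szbs : (size bs).+1 = n)
  (sl : sorted ltn [:: n, x & bs]).

Let c := set_index [:: n, x & bs].
Let z := last 0 bs.

Lemma sorted_bounds : sorted ltn bs.
Proof. by move: sl => /= /andP[_ /path_sorted]. Qed.

Lemma index_min : elt c 0 = n.
Proof. by rewrite /c elt_set_index. Qed.

Lemma index_second : elt c 1 = x.
Proof. by rewrite /c elt_set_index. Qed.

Lemma modulusE : modulus c = z.
Proof.
rewrite /modulus index_min /c elt_set_index //= /z -nth_last -szbs.
by congr nth; lia.
Qed.

Lemma second_lt_modulus : x < z.
Proof.
move: sl => /= /andP[_ /(order_path_min ltn_trans) /allP]; apply.
by rewrite /z; case: bs szbs n2 => [<- //|b bs' _ _]; rewrite /= mem_last.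
Qed.

Lemma modulus_gt1 : 1 < z.
Proof.
have [/= nx _] := andP sl.
by apply: leq_trans n2 _; apply: ltnW (ltn_trans nx second_lt_modulus).
Qed.

Lemma boundE d : bound c d = if d.+1 < size bs then nth 0 bs d else 0.
Proof. by rewrite /bound index_min /c elt_set_index //= -szbs ltnS. Qed.

Lemma entry_lt R j : entry c R j < z.
Proof.
rewrite /entry modulusE; apply: node_lt; first exact: modulus_gt1.
by rewrite ltn_pmod // ltnW // modulus_gt1.
Qed.

(** Induction on the fuel: subcodes are at most [i], and quantified values lie below an entry of
    [bs], hence below [z], so all the values needed are again inside the table. *)
Lemma lookup_table k i rho : i < n -> 0 < size rho < n -> all (gtn z) rho ->
  lookup c (table c k) i (size rho).-1 (env_code z rho) = beval bs k i rho.
Proof.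
elim: k i rho => [|k IH] i rho ilt hrho rz.
  by rewrite /lookup /table /= div0n mod0n.
have z1 := modulus_gt1.
set d := (size rho).-1; set e := env_code z rho.
have dn : d < n by rewrite /d; lia.
have eM : e < env_bound c.
  rewrite /env_bound modulusE index_min; apply: leq_trans (env_code_lt rz) _.
  by rewrite leq_pexp2l //; lia.
rewrite /lookup [table c k.+1]/= -/(table c k) index_min modulusE.
set M := env_bound c in eM *.
rewrite digit_lt; last 2 first.
- by move=> j; exact: entry_lt.
(* The position lies below [n * n * M], since [i] and [d] are below [n] and [e] is below [M]. *)
- apply: (@leq_trans ((i * n + d).+1 * M)).
    by rewrite mulSn addnC ltn_add2r.
  by rewrite leq_mul2r; apply/orP; right; nia.
have M0 : 0 < M by exact: leq_ltn_trans eM.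
rewrite /entry -/M index_min divnMDl // (divn_small eM) addn0.
rewrite modnMDl (modn_small eM) divnMDl ?(divn_small dn) ?addn0; last by lia.
rewrite modnMDl (modn_small dn) modulusE /beval /= -/(beval bs).
have lefti : code_left i < n by apply: leq_ltn_trans ilt; exact: geq_minl.
have righti : code_right i < n by apply: leq_ltn_trans ilt; exact: geq_minl.
rewrite digit_env_code // !IH //; congr node.
rewrite boundE /below /d prednK; last by case/andP: hrho.
case: ifP => hs //; apply: eq_in_has => y; rewrite mem_iota add0n /= => hy.
rewrite -(IH _ (y :: rho)) //=.
  by rewrite -szbs ltnS.
rewrite rz andbT; apply: leq_trans hy _; apply: sorted_le_last; last by lia.
exact: sorted_bounds.
Qed.

End Table.

(** * The coloring on sorted lists *)

Definition same_type (n : nat) (bs : seq nat) (y x : nat) : bool :=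
  (1 < n) && all (fun i => (0 < beval bs n i [:: y]) ==
                           (0 < beval bs n i [:: x])) (iota 0 n).

Definition same_type_before (n : nat) (bs : seq nat) (x : nat) : seq nat :=
  [seq y <- iota 0 x | (n < y) && same_type n bs y x].

(** Exactly one earlier number of the same type means that [x] is the second of its type above [n];
    it then gives way to the first. *)
Definition leader (n : nat) (bs : seq nat) (x : nat) : nat :=
  if same_type_before n bs x is [:: a] then a else x.

Definition recolor (l : seq nat) : seq nat :=
  if l is [:: n, x & bs] then [:: n, leader n bs x & bs] else l.

Lemma same_typeP n bs y x : reflect
  (1 < n /\ forall i, i < n -> (0 < beval bs n i [:: y]) =
                               (0 < beval bs n i [:: x]))
  (same_type n bs y x).
Proof.
apply: (iffP andP) => -[n1 h]; split=> //.
  move=> i ilt; have := allP h i.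
  by rewrite mem_iota add0n ilt => /(_ isT)/eqP.
by apply/allP => i; rewrite mem_iota => /andP[_ ilt]; rewrite h.
Qed.

Lemma same_type_trans n bs a x y :
  same_type n bs a x -> same_type n bs a y -> same_type n bs x y.
Proof.
move=> /same_typeP[n1 h1] /same_typeP[_ h2]; apply/same_typeP; split=> // i ilt.
by rewrite -h1 // h2.
Qed.

Lemma mem_same_type_before n bs x y : (y \in same_type_before n bs x) =
  [&& y < x, n < y & same_type n bs y x].
Proof. by rewrite mem_filter mem_iota add0n /= andbC. Qed.

Variant leader_spec n bs x : nat -> bool -> Type :=
| LeaderSelf : leader_spec n bs x x false
| LeaderBefore a of n < a < x & same_type_before n bs x = [:: a] :
    leader_spec n bs x a true.

Lemma leaderP n bs x :
  leader_spec n bs x (leader n bs x) (size (same_type_before n bs x) == 1).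
Proof.
have := mem_same_type_before n bs x; rewrite /leader.
case e: (same_type_before n bs x) => [|a [|b t]] h /=.
- exact: LeaderSelf.
- apply: LeaderBefore => //; have := h a; rewrite inE eqxx.
  by move=> /esym/and3P[-> ->].
- exact: LeaderSelf.
Qed.

Lemma leader_bounds n bs x : n < x -> n < leader n bs x <= x.
Proof. by case: leaderP => [->|a /andP[-> /ltnW ->]] /=. Qed.

Lemma sorted_recolor l : sorted ltn l -> sorted ltn (recolor l).
Proof.
case: l => [|n [|x bs]] //= /andP[nx].
have /andP[-> le] := leader_bounds bs nx.
by case: bs le => //= b bs le /andP[xb ->]; rewrite (leq_ltn_trans le xb).
Qed.

Lemma table_leaderE n x bs : (size bs).+1 = n -> sorted ltn [:: n, x & bs] ->
  table_leader (set_index [:: n, x & bs]) x = leader n bs x.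
Proof.
move=> szbs sl; set c := set_index _.
have cn : elt c 0 = n by rewrite index_min.
have teq y : y < x -> table_equiv c y x = same_type n bs y x.
  move=> yx; rewrite /table_equiv /same_type cn; case: ltnP => //= n2.
  apply: eq_in_all => i; rewrite mem_iota add0n /= => ilt.
  (* The numbers up to [x] lie below the modulus, hence are codes of environments of length 1. *)
  have xz := second_lt_modulus n2 szbs sl.
  have h w : w < last 0 bs ->
      lookup c (table c n) i 0 w = beval bs n i [:: w].
    move=> wz; rewrite -(lookup_table n2 szbs sl) //= ?wz // muln0 addn0 //.
  by rewrite !h // (ltn_trans yx).
rewrite /table_leader cn.
have -> : \sum_(0 <= y < x) ((n < y) && table_equiv c y x) =
    size (same_type_before n bs x).
  rewrite sum_nat_pred size_filter; apply: eq_in_count => y.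
  by rewrite mem_iota add0n /= => yx; rewrite teq.
have -> : \sum_(0 <= y < x) y * ((n < y) && table_equiv c y x) =
    sumn (same_type_before n bs x).
  rewrite sumnE big_filter /index_iota subn0 [RHS]big_mkcond.
  rewrite !big_seq; apply: eq_bigr => y; rewrite mem_iota add0n /= => yx.
  by rewrite teq //; case: andb; rewrite ?muln1 ?muln0.
rewrite /leader; case: (same_type_before n bs x) => [|a [|b t]] //=.
by rewrite addn0.
Qed.

Lemma index_coloringE l : sorted ltn l -> size l = (head 0 l).+1 ->
  index_coloring (set_index l) = set_index (recolor l).
Proof.
case: l => [|n [|x bs]] //= sl [szbs].
  (* The set is {0}: the missing second element reads as 0, and the same power of 2 is subtracted
     and added back. *)
  rewrite -szbs /index_coloring elt_set_index //= /table_leader big_geq //=.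
  rewrite subnK //.
  by rewrite /set_index big_seq1.
rewrite /index_coloring index_second // table_leaderE //.
rewrite /set_index !big_cons; lia.
Qed.

Definition replaced (l : seq nat) : bool :=
  if l is [:: n, x & bs] then size (same_type_before n bs x) == 1 else false.

(** If neither second element is replaced, the lists are unchanged. If both are replaced by [a] and
    differ, then by transitivity the smaller is, besides [a], an earlier number of the type of the
    larger. *)
Lemma recolor_inj l1 l2 : recolor l1 = recolor l2 ->
  replaced l1 = replaced l2 -> l1 = l2.
Proof.
case: l1 => [|n [|x bs]]; case: l2 => [|n' [|x' bs']] //=.
move=> [<- el eb]; rewrite -{bs'}eb in el *; move: el.
case: leaderP => [|a /andP[na ax] ea]; case: leaderP => //; first by move=> ->.
move=> a' _ ea' aa' _; rewrite -{a'}aa' in ea'.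
have lt_false u v : same_type_before n bs u = [:: a] ->
    same_type_before n bs v = [:: a] -> u < v -> False.
  move=> eu ev uv.
  have := mem_same_type_before n bs u a; rewrite eu inE eqxx.
  move=> /esym/and3P[au _ tau].
  have := mem_same_type_before n bs v a; rewrite ev inE eqxx.
  move=> /esym/and3P[_ _ tav].
  have := mem_same_type_before n bs v u; rewrite ev inE uv (ltn_trans na au).
  by rewrite (same_type_trans tau tav) (gtn_eqF au).
by case: (ltngtP x x') => [/(lt_false _ _ ea ea')|/(lt_false _ _ ea' ea)|->].
Qed.

(** * Exactly omega-large sets as sorted lists *)

Definition sorted_elements (s : large_set) : seq nat := sort leq (val s).

Lemma sorted_sorted_elements s : sorted ltn (sorted_elements s).
Proof.
rewrite ltn_sorted_uniq_leq sort_uniq fset_uniq sort_sorted //.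
exact: leq_total.
Qed.

Lemma size_sorted_elements s :
  size (sorted_elements s) = (head 0 (sorted_elements s)).+1.
Proof. by rewrite size_sort; exact/eqP/(valP s). Qed.

Lemma canonical_indexE s :
  canonical_index (val s) = set_index (sorted_elements s).
Proof. by apply: perm_big; rewrite perm_sym perm_sort. Qed.

Lemma sorted_elements_inj : injective sorted_elements.
Proof.
move=> s1 s2 e; apply/val_inj/fsetP => x.
by rewrite -(mem_sort leq) -[RHS](mem_sort leq) -/(sorted_elements s1) e.
Qed.

Lemma large_set_of_sorted l : sorted ltn l -> size l = (head 0 l).+1 ->
  exists s, sorted_elements s = l.
Proof.
move=> sl hl; pose f := [fset x in l]%fset.
have e : sort leq f = l.
  apply: (irr_sorted_eq ltn_trans ltnn _ sl).
    rewrite ltn_sorted_uniq_leq sort_uniq fset_uniq sort_sorted //.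
    exact: leq_total.
  by move=> x; rewrite mem_sort !inE.
have fl : exactly_large f.
  by rewrite /exactly_large /fset_min e -(size_sort leq) e hl.
by exists (exist _ f fl).
Qed.

Definition coloring (s : large_set) : nat :=
  set_index (recolor (sorted_elements s)).

Lemma computable_coloring_coloring : computable_coloring coloring.
Proof.
have [p hp] := crec_index_coloring; exists p => s.
have := hp [:: canonical_index (val s)] erefl; rewrite /= canonical_indexE.
rewrite index_coloringE //; first exact: sorted_sorted_elements.
exact: size_sorted_elements.
Qed.

(** The bit [replaced] separates the elements of a color class, by [recolor_inj]. *)
Lemma bounded_coloring_coloring : bounded_coloring 2 coloring.
Proof.
move=> y; have [] // : $|{injfun (coloring @^-1` [set y])%classic >-> `I_2}|.
  apply/injfunPex; exists (fun s => replaced (sorted_elements s) : nat).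
    by move=> s _ /=; case: replaced.
  move=> s1 s2; rewrite !inE => /= c1 c2 er; apply: sorted_elements_inj.
  apply: recolor_inj.
    apply: set_index_inj; try exact/sorted_recolor/sorted_sorted_elements.
    by rewrite -/(coloring s1) c1 -c2.
  by move: er; do 2 case: replaced.
exact: inj_card_le.
Qed.

(** * Convergence of the bounded evaluation *)

(* For all large enough s_1, for all large enough s_2, and so on, P holds of
   the list of the s_i. *)
Fixpoint evt (r : nat) (P : seq nat -> Prop) : Prop :=
  if r is r'.+1
  then exists N, forall s, N <= s -> evt r' (fun ss => P (s :: ss))
  else P [::].

Lemma evt_imp r (P Q : seq nat -> Prop) :
  (forall ss, size ss = r -> P ss -> Q ss) -> evt r P -> evt r Q.
Proof.
elim: r P Q => [|r IH] P Q /= PQ; first exact: PQ.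
move=> [N hN]; exists N => s /hN; apply: IH => ss hss.
by apply: PQ; rewrite /= hss.
Qed.

Lemma evt_true r (P : seq nat -> Prop) :
  (forall ss, size ss = r -> P ss) -> evt r P.
Proof.
elim: r P => [|r IH] P /= hP; first exact: hP.
by exists 0 => s _; apply: IH => ss hss; apply: hP; rewrite /= hss.
Qed.

Lemma evt_and r (P Q : seq nat -> Prop) : evt r P -> evt r Q ->
  evt r (fun ss => P ss /\ Q ss).
Proof.
elim: r P Q => [|r IH] P Q //= [N hN] [M hM]; exists (maxn N M) => s.
by rewrite geq_max => /andP[/hN hP /hM hQ]; exact: IH.
Qed.

Lemma evt_forall r m (P : nat -> seq nat -> Prop) :
  (forall y, y < m -> evt r (P y)) ->
  evt r (fun ss => forall y, y < m -> P y ss).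
Proof.
elim: m => [|m IH] hP; first exact: evt_true.
have := evt_and (IH (fun y ym => hP y (ltnW ym))) (hP m (leqnn _)).
apply: evt_imp => ss _ [h1 h2] y; rewrite ltnS leq_eqVlt => /predU1P[->//|].
exact: h1.
Qed.

Lemma evt_last r a N : evt r.+1 (fun ss => N <= last a ss).
Proof.
elim: r a => [|r IH] a; first by exists N.
by exists 0 => s _; exact: (IH s).
Qed.

(** Each threshold depends only on the entries already chosen, so the entries can be picked in [H]
    one after the other. *)
Lemma evt_in (H : nat -> Prop) r P N :
  (forall M, exists2 x, M < x & H x) -> evt r P ->
  exists ss, [/\ size ss = r, path ltn N ss,
                 (forall x, x \in ss -> H x) & P ss].
Proof.
move=> hH; elim: r P N => [|r IH] P N /=; first by exists [::].
move=> [M hM]; have [x] := hH (maxn N M); rewrite gtn_max => /andP[Nx Mx] Hx.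
have [ss [szss pss Hss Pss]] := IH _ x (hM x (ltnW Mx)).
exists (x :: ss); split=> //=; rewrite ?szss ?Nx //.
by move=> y; rewrite inE => /predU1P[->|/Hss].
Qed.

(** The cutoff [m] plays the role of the size of [bs] in [below]: quantifiers left without a bound
    there are false here too. *)
Definition unbounded (m d : nat) (p : pred nat) : bool :=
  (d < m) && `[< exists y, p y >].

Definition ieval (m : nat) := eval 0 (unbounded m).

Lemma node_mod0 z op var a b q : a + b < z -> a * b < z ->
  node z op var a b q = node 0 op var a b q.
Proof. by move=> h1 h2; rewrite /node !modn0 !modn_small. Qed.

(** Induction on the fuel. As [rho] has one more entry than [bs], the first entry of [ss] bounds an
    outermost quantifier, unless it is also the last one, which is the modulus. *)
Lemma evt_eval k i rho bs r m : size rho = (size bs).+1 ->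
  size bs + r.+1 = m ->
  evt r.+1 (fun ss => beval (bs ++ ss) k i rho = ieval m k i rho).
Proof.
elim: k i rho bs r => [|k IH] i rho bs r hrho hm; first exact: evt_true.
set L := ieval m k (code_left i) rho; set R := ieval m k (code_right i) rho.
have hL := IH (code_left i) rho bs r hrho hm.
have hR := IH (code_right i) rho bs r hrho hm.
(* A modulus above the sum and the product of the true values makes the reductions harmless. *)
have hz := evt_last r (last 0 bs) (maxn (L + R) (L * R)).+1.
have hq : evt r.+1 (fun ss => below (bs ++ ss) (size rho)
      (fun y => 0 < beval (bs ++ ss) k (code_left i) (y :: rho)) =
    unbounded m (size rho) (fun y => 0 < ieval m k (code_left i) (y :: rho))).
  (* With one entry left, only the modulus remains, and both sides are false by the cutoff. *)
  case: r hm {hL hR hz} => [|r] hm.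
    apply: evt_true => ss hss; rewrite /below /unbounded size_cat hss hrho.
    by rewrite -hm addn1 ltnn.
  (* [N] exceeds some witness if there is one. *)
  have [N hN] : exists N, (exists y, 0 < ieval m k (code_left i) (y :: rho)) ->
      exists2 y, y < N & 0 < ieval m k (code_left i) (y :: rho).
    case: (pselect (exists y, 0 < ieval m k (code_left i) (y :: rho))).
      by move=> [y hy]; exists y.+1 => _; exists y.
    by move=> h; exists 0 => /h.
  exists N => s Ns.
  (* Only the finitely many [y < s] are tried, and the later entries can be chosen to suit all of
     them. *)
  have : evt r.+1 (fun ss => forall y, y < s ->
      beval (rcons bs s ++ ss) k (code_left i) (y :: rho) =
      ieval m k (code_left i) (y :: rho)).
    apply: evt_forall => y _; apply: IH; rewrite ?size_rcons /= ?hrho //.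
    by rewrite -hm addSnnS.
  have lt_m : size rho < m by rewrite hrho; lia.
  apply: evt_imp => ss hss h; rewrite /below /unbounded size_cat /= hss hm lt_m.
  rewrite hrho /= nth_cat ltnn subnn /=.
  apply/hasP/asboolP => [[y]|/hN[y yN hy]].
    by rewrite mem_iota -cat_rcons => /andP[_ ys]; rewrite h //; exists y.
  exists y; first by rewrite mem_iota (leq_trans yN).
  by rewrite -cat_rcons h // (leq_trans yN).
have := evt_and (evt_and hL hR) (evt_and hz hq).
apply: evt_imp => ss hss [[eL eR] [ez eq]].
rewrite /ieval /beval /= -/(ieval m) -/(beval (bs ++ ss)) eL eR eq last_cat.
by apply: node_mod0; apply: leq_trans ez; rewrite ltnS ?leq_maxl ?leq_maxr.
Qed.

(** * Codes of formulas *)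

Definition mkcode (op a b : nat) : nat :=
  set_index [:: op; op.+1 + a; (op.+1 + a).+1 + b].

(** The truncations are harmless: both subcodes are at most the largest element of the set, which is
    below its index. *)
Lemma mkcodeK op a b :
  [/\ code_op (mkcode op a b) = op, code_left (mkcode op a b) = a
    & code_right (mkcode op a b) = b].
Proof.
have sl : sorted ltn [:: op; op.+1 + a; (op.+1 + a).+1 + b] by rewrite /=; lia.
have lt x : x \in [:: op; op.+1 + a; (op.+1 + a).+1 + b] -> x < mkcode op a b.
  exact: mem_lt_set_index.
have := lt ((op.+1 + a).+1 + b); rewrite !inE eqxx !orbT => /(_ isT) h.
by rewrite /code_op /code_left /code_right !elt_set_index //=; split; lia.
Qed.

(** One code must serve all large enough fuels and cutoffs. The cutoff is relative to the length of
    [rho], which grows under quantifiers. *)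
Definition coded (f : seq nat -> nat) : Prop :=
  exists i k0 m0, forall k m rho, k0 <= k -> size rho + m0 <= m ->
    ieval m k i rho = f rho.

Lemma coded_var a : coded (fun rho => nth 0 rho a).
Proof.
exists (mkcode 0 a 0), 1, 0 => -[//|k] m rho _ _.
by rewrite /ieval /=; have [-> -> _] := mkcodeK 0 a 0.
Qed.

Lemma coded_binop op (F : nat -> nat -> nat) f g :
  (forall v a b q, node 0 op v a b q = F a b) -> coded f -> coded g ->
  coded (fun rho => F (f rho) (g rho)).
Proof.
move=> hF [i [k1 [m1 hi]]] [j [k2 [m2 hj]]].
exists (mkcode op i j), (maxn k1 k2).+1, (maxn m1 m2) => -[//|k] m rho hk hm.
rewrite /ieval /= -/(ieval m); have [-> -> ->] := mkcodeK op i j.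
by rewrite hF hi ?hj //; lia.
Qed.

Lemma codedD f g : coded f -> coded g -> coded (fun rho => f rho + g rho).
Proof. by apply: (@coded_binop 1 addn) => *; rewrite /node /= modn0. Qed.

Lemma codedM f g : coded f -> coded g -> coded (fun rho => f rho * g rho).
Proof. by apply: (@coded_binop 2 muln) => *; rewrite /node /= modn0. Qed.

Lemma coded_eq f g : coded f -> coded g -> coded (fun rho => f rho == g rho).
Proof. exact: (@coded_binop 3 (fun a b => a == b)). Qed.

Lemma coded_ex f : coded f ->
  coded (fun rho => `[< exists y, 0 < f (y :: rho) >]).
Proof.
move=> [i [k0 [m0 hi]]].
(* The extra unit of cutoff pays for the value that the quantifier pushes on the environment. *)
exists (mkcode 4 i 0), k0.+1, m0.+1 => -[//|k] m rho hk hm.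
rewrite /ieval /= -/(ieval m); have [-> -> _] := mkcodeK 4 i 0.
rewrite /node /= /unbounded (_ : size rho < m) /=; last by lia.
congr (nat_of_bool (asbool _)); apply/propext; split=> -[y hy]; exists y;
  by move: hy; rewrite hi //=; lia.
Qed.

(** Constants have no operation of their own: 1 is obtained as the truth value of an identity, then
    0 as that of [1 = 2]. *)
Lemma coded1 : coded (fun=> 1).
Proof.
have [i [k0 [m0 hi]]] := coded_eq (coded_var 0) (coded_var 0).
by exists i, k0, m0 => k m rho hk hm; rewrite hi // eqxx.
Qed.

Lemma coded0 : coded (fun=> 0).
Proof. exact: coded_eq coded1 (codedD coded1 coded1). Qed.

Lemma coded_term t : coded (fun rho => teval (nth 0 rho) t).
Proof.
elim: t => [a||t IH|t1 IH1 t2 IH2|t1 IH1 t2 IH2] /=.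
- exact: coded_var.
- exact: coded0.
- have [i [k0 [m0 hi]]] := codedD IH coded1.
  by exists i, k0, m0 => k m rho hk hm; rewrite hi // addn1.
- exact: codedD.
- exact: codedM.
Qed.

Lemma env_cons_nth y rho : env_cons y (nth 0 rho) = nth 0 (y :: rho).
Proof. by apply/funext => -[]. Qed.

Lemma coded_formula phi : coded (fun rho => `[< sat (nth 0 rho) phi >]).
Proof.
have ext f g : coded f -> (forall rho, f rho = g rho) -> coded g.
  by move=> [i [k0 [m0 hi]]] fg; exists i, k0, m0 => *; rewrite hi.
elim: phi => [t1 t2|phi IH|phi1 IH1 phi2 IH2|phi IH] /=.
- apply: (ext _ _ (coded_eq (coded_term t1) (coded_term t2))) => rho.
  by congr nat_of_bool; apply/eqP/asboolP.
(* Negation is equality with 0, and conjunction, next, is multiplication. *)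
- apply: (ext _ _ (coded_eq IH coded0)) => rho.
  by rewrite asbool_neg; case: asbool.
- apply: (ext _ _ (codedM IH1 IH2)) => rho.
  by rewrite asbool_and mulnb.
- apply: (ext _ _ (coded_ex IH)) => rho.
  congr (nat_of_bool (asbool _)); apply/propext.
  by split=> -[y]; rewrite ?lt0b ?env_cons_nth => /asboolP hy; exists y;
    rewrite ?lt0b ?env_cons_nth //; apply/asboolP.
Qed.

(** * Infinite sets and the contradiction *)

Lemma infinite_setP (H : set nat) : infinite_set H ->
  forall M, exists2 x, M < x & H x.
Proof.
move=> hH M; apply: contrapT => hM; apply: hH.
apply: (sub_finite_set _ (finite_II M.+1)) => x Hx /=.
by rewrite ltnS leqNgt; apply/negP => Mx; apply: hM; exists x.
Qed.

(** Otherwise [f] would inject the part of [H] above [n] into the finite type [T]. *)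
Lemma infinite_pigeonhole (T : finType) (H : set nat) (f : nat -> T) n :
  infinite_set H -> exists x y, [/\ n < x, x < y, H x, H y & f x = f y].
Proof.
move=> hH; apply: contrapT => hf; apply: hH.
pose A := (H `&` [set x | n < x])%classic.
have finA : finite_set A.
  have [g] : $|{injfun A >-> [set: T]}|.
    apply/injfunPex; exists f; first by [].
    move=> x y; rewrite !inE => -[Hx nx] [Hy ny] fxy.
    by case: (ltngtP x y) => // xy; exfalso; apply: hf;
      [exists x, y | exists y, x].
  exact: (card_le_finite (inj_card_le g) finite_finset).
have : finite_set (A `|` `I_n.+1)%classic.
  by rewrite finite_setU; split=> //; exact: finite_II.
apply: sub_finite_set => x Hx /=; case: (ltnP n x) => nx; first by left.
by right.
Qed.

Theorem theorem4p10 :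
  exists g : large_set -> nat,
    [/\ computable_coloring g,
        bounded_coloring 2 g
      & forall H : set nat,
          infinite_set H ->
          {in large_subsets H &, injective g} ->
          ~ arithmetical H].
Proof.
exists coloring; split; first exact: computable_coloring_coloring.
  exact: bounded_coloring_coloring.
move=> H infH injH [phi hphi].
have [i [k0 [m0 hi]]] := coded_formula phi.
have unbH := infinite_setP infH.
(* The bound makes [i] one of the codes below [n], and makes fuel [n] and cutoff [n - 1] sufficient
   for it on environments of length 1. *)
have [n] := unbH (maxn (maxn i k0) m0.+2); rewrite !gtn_max.
move=> /andP[/andP[in_ kn] mn] Hn.
pose t x := [ffun j : 'I_n => 0 < ieval n.-1 n j [:: x]].
(* Membership in [H] is the component [i] of the true type. *)
have HE x : H x <-> t x (Ordinal in_).
  rewrite ffunE hi /=; [|by lia|by lia].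
  rewrite (hphi x (nth 0 [::])) env_cons_nth lt0b.
  by split=> [h|/asboolP//]; apply/asboolP.
have [x [x' [nx xx' Hx Hx' txx']]] := infinite_pigeonhole t n infH.
(* [a] and [b] will be the first two numbers above [n] of this type; the pigeonhole pair ensures
   that they exist. *)
have exa : exists a, (n < a) && (t a == t x) by exists x; rewrite nx eqxx.
case: (ex_minnP exa) => a /andP[na /eqP ta] mina.
have ax : a <= x by apply: mina; rewrite nx eqxx.
have exb : exists b, (a < b) && (t b == t x).
  by exists x'; rewrite -txx' eqxx (leq_ltn_trans ax xx').
case: (ex_minnP exb) => b /andP[ab /eqP tb] minb.
have Ha : H a by apply/HE; rewrite ta; apply/HE.
have Hb : H b by apply/HE; rewrite tb; apply/HE.
(* The same [n - 1] entries serve [a] and [b]: they lie above [b] and evaluate all codes below [n]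
   correctly at all numbers up to [b]. *)
have [ss [szss pss Hss conv]] : exists ss, [/\ size ss = n.-2.+1, path ltn b ss,
    (forall y, y \in ss -> H y)
  & forall y, y < b.+1 -> forall j, j < n ->
      beval ss n j [:: y] = ieval n.-1 n j [:: y]].
  apply: (evt_in _ unbH); apply: evt_forall => y _; apply: evt_forall => j _.
  by apply: (@evt_eval _ _ _ [::]) => //=; lia.
have n1 : 1 < n by lia.
(* Up to [b], the types computed from [ss] compare as the true ones do. *)
have stE y y' : y <= b -> y' <= b -> same_type n ss y y' = (t y == t y').
  move=> yb yb'; apply/same_typeP/eqP => [[_ h]|h].
    by apply/ffunP => j; rewrite !ffunE -!conv ?ltnS //; apply: h.
  split=> // j jn; rewrite !conv ?ltnS //.
  have := congr1 (fun f : {ffun 'I_n -> bool} => f (Ordinal jn)) h.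
  by rewrite !ffunE.
have noa : same_type_before n ss a = [::].
  apply/nilP; rewrite /nilp -leqn0 leqNgt -has_predT; apply/hasPn => y.
  rewrite mem_same_type_before => /and3P[ya ny]; rewrite stE; [|lia|lia].
  rewrite ta => tyx; have := mina y; rewrite ny tyx => /(_ isT); lia.
have onlya : same_type_before n ss b = [:: a].
  apply: perm_small_eq => //; apply: uniq_perm => //.
    exact/filter_uniq/iota_uniq.
  move=> y; rewrite mem_same_type_before inE; apply/and3P/eqP => [[yb ny]|->].
    rewrite stE; [|lia|lia]; rewrite tb => tyx.
    have := mina y; rewrite ny tyx => /(_ isT) ay.
    have := minb y; rewrite tyx andbT; case: (ltngtP a y) ay => // ay _.
    by move=> /(_ isT); lia.
  by split=> //; rewrite stE ?ta ?tb //; lia.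
have srt y : n < y -> y <= b -> sorted ltn [:: n, y & ss].
  move=> ny yb; rewrite /= ny /=; case: (ss) pss => //= s0 ss' /andP[bs0 ->].
  by rewrite (leq_ltn_trans yb bs0).
have sz y : size [:: n, y & ss] = (head 0 [:: n, y & ss]).+1.
  by rewrite /= szss; lia.
have [sa esa] := large_set_of_sorted (srt a na (ltnW ab)) (sz a).
have [sb esb] := large_set_of_sorted (srt b (ltn_trans na ab) (leqnn b)) (sz b).
have sub y s : sorted_elements s = [:: n, y & ss] -> H y ->
    s \in large_subsets H.
  move=> es Hy; rewrite inE => w.
  rewrite -(mem_sort leq) -/(sorted_elements s) es.
  by rewrite !inE => /or3P[/eqP->|/eqP->|/Hss].
have : sa = sb.
  apply: injH; [exact: sub esa Ha|exact: sub esb Hb|].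
  (* Both leaders are [a]: no number between [n] and [a] has its type, and [a] is the only one
     between [n] and [b]. *)
  by rewrite /coloring esa esb /= /leader noa onlya.
move=> /(congr1 sorted_elements); rewrite esa esb => -[ab'].
by rewrite ab' ltnn in ab.
Qed.
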